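(* Let $n>1$ be an integer and let $(\Omega,\mathcal H,\hat{\mathbb E})$ be a nonlinear expectation space. Then the following two claims are equivalent: (a) $\hat{\mathbb E}$ is linear, i.e., for any $\lambda,\gamma\in\mathbb R$ and $X,Y\in\mathcal H$, $\hat{\mathbb E}[\lambda X+\gamma Y]=\lambda\hat{\mathbb E}[X]+\gamma\hat{\mathbb E}[Y]$; (b) the $n$-dimensional Jensen inequality holds for $\hat{\mathbb E}$, i.e., for all $X_1,\dots,X_n\in\mathcal H$ and every convex function $h:\mathbb R^n\to\mathbb R$, if $h(X_1,\dots,X_n)\in\mathcal H$, then $$\hat{\mathbb E}[h(X_1,\dots,X_n)]\ge h(\hat{\mathbb E}[X_1],\dots,\hat{\mathbb E}[X_n]).$$
   Context: A nonlinear expectation space $(\Omega,\mathcal H,\hat{\mathbb E})$ consists of a set $\Omega$, a linear space $\mathcal H$ of real-valued functions on $\Omega$ that contains every constant function and satisfies $|X|\in\mathcal H$ whenever $X\in\mathcal H$, and a functional $\hat{\mathbb E}:\mathcal H\to\mathbb R$ (a nonlinear expectation) satisfying: (i) monotonicity: $\hat{\mathbb E}[X]\ge\hat{\mathbb E}[Y]$ if $X\ge Y$; (ii) constant preserving: $\hat{\mathbb E}[c]=c$ for $c\in\mathbb R$. No sub-additivity or homogeneity is assumed. *)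

(* Defs.v *)
From HB Require Import structures.
From mathcomp Require Import all_boot all_order all_algebra.
From mathcomp Require Import boolp classical_sets reals convex.

Set Implicit Arguments.
Unset Strict Implicit.
Unset Printing Implicit Defensive.

Import Order.TTheory GRing.Theory Num.Theory.
Local Open Scope classical_set_scope.
Local Open Scope ring_scope.

(* A functional on [H] is represented by a function [E] on all of
   [Omega -> R]; its values outside [H] are arbitrary, and every condition
   below evaluates [E] on members of [H] only.  [Omega] need not be assumed
   nonempty: [nes_const_preserving] is contradictory when it is empty. *)
Record nonlinear_expectation_space (R : realType) (Omega : Type)
    (H : set (Omega -> R)) (E : (Omega -> R) -> R) : Prop := {
  nes_lin_closed : forall (a b : R) (X Y : Omega -> R), H X -> H Y ->
    H (fun w => a * X w + b * Y w) ;
  nes_const_closed : forall c : R, H (fun=> c) ;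
  nes_abs_closed : forall X : Omega -> R, H X -> H (fun w => `|X w|) ;
  nes_monotone : forall X Y : Omega -> R, H X -> H Y ->
    (forall w, Y w <= X w) -> E Y <= E X ;
  nes_const_preserving : forall c : R, E (fun=> c) = c
}.

Definition linear_expectation (R : realType) (Omega : Type)
    (H : set (Omega -> R)) (E : (Omega -> R) -> R) : Prop :=
  forall (l g : R) (X Y : Omega -> R), H X -> H Y ->
    E (fun w => l * X w + g * Y w) = l * E X + g * E Y.

Definition jensen_inequality (n : nat) (R : realType) (Omega : Type)
    (H : set (Omega -> R)) (E : (Omega -> R) -> R) : Prop :=
  forall (X : 'I_n -> Omega -> R) (h : 'rV[R]_n -> R),
    (forall i, H (X i)) ->
    convex_function (E := 'rV[R]_n) setT h ->
    H (fun w => h (\row_i X i w)) ->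
    h (\row_i E (X i)) <= E (fun w => h (\row_i X i w)).

(* Main.v *)
Require Import Defs.
From mathcomp Require Import all_boot all_order all_algebra.
From mathcomp Require Import boolp classical_sets reals convex.
From mathcomp Require Import interval_inference ring lra.

(** Linearity implies Jensen because a finite convex function on [R^n] lies
    above an affine function touching it at the point [(E X_i)_i], and a monotone
    linear constant-preserving [E] commutes with affine functions. The supporting
    slope is built one coordinate at a time, as in the Hahn-Banach theorem.
    Conversely, Jensen for linear functions of two variables says that
    [E (l X + g Y) >= l E X + g E Y] for all real [l], [g]; applied to
    [0 = Z - Z] this gives [E (- Z) = - E Z], and negating the coefficients
    yields the reverse inequality. *)

Set Implicit Arguments.
Unset Strict Implicit.
Unset Printing Implicit Defensive.

Import Order.TTheory GRing.Theory Num.Theory.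
Local Open Scope classical_set_scope.
Local Open Scope ring_scope.

Lemma convex_functionTP (R : realType) (V : lmodType R) (f : V -> R) :
  convex_function (E := V) setT f <->
  forall (t : R) (x y : V), 0 <= t <= 1 ->
    f (t *: x + (1 - t) *: y) <= t * f x + (1 - t) * f y.
Proof.
split=> [cf t x y t01 | cf t x y _ _].
  have t01' : Itv.spec (@Itv.num_sem R) (Itv.Real `[0%Z, 1%Z]) t.
    rewrite /Itv.spec /= /Itv.num_sem /= in_itv /= t01 andbT.
    by case/andP: t01 => /ger0_real.
  by have := cf (Itv.mk t01') x y (in_setT _) (in_setT _).
by apply: cf; rewrite ge0 le1.
Qed.

(** The one-dimensional Hahn-Banach step. Each [t < 0] bounds [s] from below by a difference
    quotient and each [t > 0] bounds it from above; convexity of [f] puts every lower bound below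
    every upper bound. *)
Lemma affine_minorant_extend (R : realType) (V : lmodType R) (f g : V -> R)
    (S : set V) (e : V) :
  convex_function (E := V) setT f -> S !=set0 ->
  (forall (t : R) (y z : V), S y -> S z -> 0 <= t <= 1 ->
     S (t *: y + (1 - t) *: z) /\
     g (t *: y + (1 - t) *: z) = t * g y + (1 - t) * g z) ->
  (forall y, S y -> g y <= f y) ->
  exists s : R, forall (t : R) (y : V), S y -> g y + s * t <= f (y + t *: e).
Proof.
move=> /convex_functionTP cf [p Sp] affg gf.
(* The slopes forced from the left stay below those allowed from the right:
   on the segment from [z - u e] to [y + t e], the point of [S] has weights
   [t / (t + u)] and [u / (t + u)]. *)
have slopes (y z : V) (t u : R) : S y -> S z -> 0 < t -> 0 < u ->
    (g z - f (z - u *: e)) / u <= (f (y + t *: e) - g y) / t.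
  move=> Sy Sz t0 u0; have tu0 : 0 < t + u by rewrite addr_gt0.
  set a := t / (t + u).
  have a1 : 1 - a = u / (t + u) by rewrite /a; field; rewrite gt_eqF.
  have a01 : 0 <= a <= 1.
    by rewrite /a divr_ge0 ?(ltW t0) ?(ltW tu0)//= ler_pdivrMr// mul1r lerDl ltW.
  have := cf a (z - u *: e) (y + t *: e) a01.
  have -> : a *: (z - u *: e) + (1 - a) *: (y + t *: e) =
            a *: z + (1 - a) *: y.
    rewrite !scalerDr scalerN !scalerA.
    have -> : (1 - a) * t = a * u by rewrite a1 /a; field; rewrite gt_eqF.
    by rewrite addrACA addNr addr0.
  have [Sc gc] := affg a z y Sz Sy a01.
  move=> /(le_trans (gf _ Sc)); rewrite gc a1 /a => le1.
  rewrite ler_pdivrMr// mulrAC ler_pdivlMr//.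
  rewrite -(ler_pM2r tu0) in le1.
  suff: t * g z + u * g y <= t * f (z - u *: e) + u * f (y + t *: e) by lra.
  move: le1; rewrite !mulrDl.
  have div_tu c d : c / (t + u) * d * (t + u) = c * d.
    by field; rewrite gt_eqF.
  by rewrite !div_tu.
pose A : set R :=
  [set r | exists z u, [/\ S z, 0 < u & r = (g z - f (z - u *: e)) / u]].
have A0 : A !=set0 by exists ((g p - f (p - 1 *: e)) / 1), p, 1.
have ubA y t : S y -> 0 < t -> ubound A ((f (y + t *: e) - g y) / t).
  by move=> Sy t0 _ [z [u [Sz u0 ->]]]; exact: slopes.
(* The point [p] makes [A] nonempty and bounded above, so [sup A] is a true supremum: being an upper
   bound settles [t < 0], being the least one settles [t > 0]. *)
exists (sup A) => t y Sy.
have [t0|t0|->] := ltrgtP t 0; last by rewrite scale0r addr0 mulr0 addr0 gf.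
- have hA : has_ubound A by exists ((f (p + 1 *: e) - g p) / 1); exact: ubA.
  have: (g y - f (y - (- t) *: e)) / - t <= sup A.
    by apply: ub_le_sup => //; exists y, (- t); rewrite oppr_gt0.
  by rewrite ler_pdivrMr ?oppr_gt0// scaleNr opprK; lra.
- have := ge_sup A0 (ubA y t Sy t0).
  by rewrite ler_pdivlMr//; lra.
Qed.

Lemma subgradient_exists (R : realType) (n : nat) (f : 'rV[R]_n -> R)
    (p : 'rV[R]_n) :
  convex_function (E := 'rV[R]_n) setT f ->
  exists c : 'I_n -> R, forall x : 'rV[R]_n, f p + \sum_i c i * (x 0 i - p 0 i) <= f x.
Proof.
move=> cf.
(* Induction on the number [k] of freed coordinates: [S 0] is the single point [p] and [S n] is the
   whole space. *)
pose S k : set 'rV[R]_n := [set x | forall i : 'I_n, (k <= i)%N -> x 0 i = p 0 i].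
suff: forall k, exists c : 'I_n -> R, forall x : 'rV[R]_n, S k x ->
    f p + \sum_i c i * (x 0 i - p 0 i) <= f x.
  case/(_ n) => c hc; exists c => x; apply: hc => i.
  by rewrite leqNgt ltn_ord.
elim=> [|k [c hc]].
  exists (fun=> 0) => x Sx; rewrite big1 ?addr0 => [|i _]; last by rewrite mul0r.
  suff -> : x = p by [].
  by apply/rowP => i; exact: Sx.
have [kn|nk] := ltnP k n; last first.
  exists c => x _; apply: hc => i ki.
  by have := leq_trans nk ki; rewrite leqNgt ltn_ord.
pose i0 := Ordinal kn; pose e : 'rV[R]_n := delta_mx 0 i0.
pose g (x : 'rV[R]_n) := f p + \sum_i c i * (x 0 i - p 0 i).
have affg (t : R) (y z : 'rV[R]_n) : S k y -> S k z -> 0 <= t <= 1 ->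
    S k (t *: y + (1 - t) *: z) /\
    g (t *: y + (1 - t) *: z) = t * g y + (1 - t) * g z.
  move=> Sy Sz _; split=> [i ki|]; first by rewrite !mxE Sy// Sz//; ring.
  rewrite /g !mulrDr addrACA -mulrDl [t + _]addrC subrK mul1r; congr +%R.
  rewrite !mulr_sumr -big_split; apply: eq_bigr => i _ /=.
  by rewrite !mxE; ring.
have Sp : S k !=set0 by exists p.
have [s hs] := affine_minorant_extend e cf Sp affg hc.
(* Overwriting [c i0] is harmless: its term vanishes on [S k], where coordinate [i0] equals that of
   [p]. Below, [y] is [x] with this coordinate reset, hence a point of [S k]. *)
exists (fun i => if i == i0 then s else c i) => x Sx.
pose t := x 0 i0 - p 0 i0; pose y := x - t *: e.
have Sy : S k y.
  move=> i; rewrite leq_eqVlt => /predU1P[ki|ki]; rewrite !mxE/=.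
    have -> : i = i0 by exact/val_inj.
    by rewrite eqxx /t mulr1 opprB addrC subrK.
  have /negPf -> : i != i0 by rewrite -val_eqE/= gtn_eqF.
  by rewrite mulr0 subr0 Sx.
have := hs t y Sy; rewrite /y subrK; apply: le_trans.
rewrite /g -addrA lerD2l (bigD1 i0)//= eqxx [in leRHS](bigD1 i0)//=.
rewrite !mxE !eqxx mulr1 /t [x 0 i0 - _ - _]addrC.
rewrite (_ : - p 0 i0 + _ = 0); last by ring.
rewrite mulr0 add0r addrC lerD2r le_eqVlt; apply/orP; left; apply/eqP.
apply: eq_bigr => i /negPf ii0.
by rewrite !mxE ii0 mulr0 subr0.
Qed.

Lemma linear_expectation_sum (R : realType) (Omega : Type)
    (H : set (Omega -> R)) (E : (Omega -> R) -> R) (I : Type) (r : seq I)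
    (c : I -> R) (X : I -> Omega -> R) :
  nonlinear_expectation_space H E -> linear_expectation H E ->
  (forall i, H (X i)) ->
  H (fun w => \sum_(i <- r) c i * X i w) /\
  E (fun w => \sum_(i <- r) c i * X i w) = \sum_(i <- r) c i * E (X i).
Proof.
(* Membership is carried along with the value, since linearity applies only to members of [H]. *)
move=> nes lin HX; elim: r => [|i r [Hr Er]].
  rewrite big_nil (_ : (fun _ => _) = fun=> 0); last first.
    by apply/funext => w; rewrite big_nil.
  by split; [exact: nes_const_closed nes _|exact: nes_const_preserving nes _].
rewrite (_ : (fun _ => _) =
    fun w => c i * X i w + 1 * \sum_(j <- r) c j * X j w); last first.
  by apply/funext => w; rewrite big_cons mul1r.
split; first exact: nes_lin_closed nes _ _ _ _ (HX i) Hr.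
by rewrite lin// Er mul1r big_cons.
Qed.

Lemma linear_expectation_jensen (R : realType) (n : nat) (Omega : Type)
    (H : set (Omega -> R)) (E : (Omega -> R) -> R) :
  nonlinear_expectation_space H E ->
  linear_expectation H E -> jensen_inequality n H E.
Proof.
move=> nes lin X h HX ch Hh.
set p := \row_i E (X i).
have [c hc] := subgradient_exists p ch.
have [HS ES] := linear_expectation_sum (index_enum 'I_n) c nes lin HX.
(* The constant term of the affine function supporting [h] at [p]. *)
pose d := h p - \sum_i c i * p 0 i.
have Hd : H (fun=> d) by exact: nes_const_closed nes _.
have -> : h p = E (fun w => 1 * d + 1 * \sum_i c i * X i w).
  rewrite (lin _ _ (fun=> d))// (nes_const_preserving nes) ES !mul1r /d.
  rewrite (eq_bigr (fun i => c i * E (X i))) ?subrK// => i _.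
  by rewrite mxE.
apply: (nes_monotone nes) => //.
  exact: (nes_lin_closed nes _ _ Hd HS).
move=> w; apply: le_trans (hc _); rewrite !mul1r /d -addrA lerD2l.
rewrite addrC -sumrB le_eqVlt; apply/orP; left; apply/eqP.
by apply: eq_bigr => i _; rewrite !mxE mulrBr.
Qed.

Lemma jensen_linear_expectation (R : realType) (n : nat) (Omega : Type)
    (H : set (Omega -> R)) (E : (Omega -> R) -> R) :
  (1 < n)%N -> nonlinear_expectation_space H E ->
  jensen_inequality n H E -> linear_expectation H E.
Proof.
move=> n1 nes jen.
have superlinear l g X Y : H X -> H Y ->
    l * E X + g * E Y <= E (fun w => l * X w + g * Y w).
  move=> HX HY; pose i0 : 'I_n := Ordinal (ltnW n1); pose i1 := Ordinal n1.
  (* The linear function reads coordinates [i0] and [i1] only, so [Y] may fill all the other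
     places. *)
  have := jen (fun i => if i == i0 then X else Y)
    (fun x : 'rV[R]_n => l * x 0 i0 + g * x 0 i1).
  rewrite (_ : (fun w : Omega => _) = fun w => l * X w + g * Y w); last first.
    by apply/funext => w; rewrite !mxE.
  rewrite !mxE/=; apply.
  - by move=> i; case: ifP.
  - apply/convex_functionTP => t x y _; rewrite !mxE le_eqVlt.
    by apply/orP; left; apply/eqP; ring.
  - exact: nes_lin_closed nes _ _ _ _ HX HY.
move=> l g X Y HX HY; apply/eqP; rewrite eq_le superlinear// andbT.
set Z := fun w => l * X w + g * Y w.
have HZ : H Z by exact: nes_lin_closed nes _ _ _ _ HX HY.
(* [N] is [- Z], written so that [superlinear] bounds [E N] below by [- (l * E X + g * E Y)];
   combined with [E Z + E N <= E 0 = 0] this bounds [E Z] above. *)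
pose N w := - l * X w + - g * Y w.
have HN : H N by exact: nes_lin_closed nes _ _ _ _ HX HY.
have EN := superlinear (- l) (- g) X Y HX HY.
have := superlinear 1 1 Z N HZ HN.
rewrite (_ : (fun w => _) = fun=> 0); last first.
  by apply/funext => w; rewrite /Z /N; ring.
rewrite (nes_const_preserving nes) -/N in EN *.
by lra.
Qed.

Theorem theorem3p3 (R : realType) (n : nat) (Omega : Type)
    (H : set (Omega -> R)) (E : (Omega -> R) -> R) :
  (1 < n)%N ->
  nonlinear_expectation_space H E ->
  (linear_expectation H E <-> jensen_inequality n H E).
Proof.
move=> n1 nes; split.
  exact: linear_expectation_jensen.
exact: jensen_linear_expectation.
Qed.
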